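(* Let $F(\boldsymbol\theta)=Z(\boldsymbol\theta)+W(\boldsymbol\theta)\mathbf j$ with $Z,W\in L^1(\mathbb T^d;\mathbb C_{\mathbf i}^{s\times s})$, and fix an ordered partition $S_L\dot\cup S_R=\{1,\dots,d\}$. The following are equivalent: (i) $T^{(S_L,S_R)}_{\boldsymbol n}(F)$ is Hermitian for all $\boldsymbol n\in\mathbb N^d$; (ii) $Z(\boldsymbol\theta)$ is Hermitian for a.e. $\boldsymbol\theta\in\mathbb T^d$ and $W(-\boldsymbol\theta)=-W(\boldsymbol\theta)^{\mathsf T}$ for a.e. $\boldsymbol\theta\in\mathbb T^d$. In particular, whether (i) holds does not depend on the choice of the ordered partition.
   Context: $\mathbb H$ is the quaternion algebra with units $\mathbf i,\mathbf j,\mathbf k=\mathbf i\mathbf j$; $\mathbb C_{\mathbf i}=\operatorname{span}_{\mathbb R}\{1,\mathbf i\}\cong\mathbb C$. A quaternion matrix $X$ is Hermitian if $X=X^*$ (quaternion conjugate transpose). $\mathbb T^d=[-\pi,\pi)^d$; $\langle\boldsymbol k,\boldsymbol\theta\rangle_S=\sum_{j\in S}k_j\theta_j$. Sandwich Fourier coefficients: $\widehat F^{(S_L,S_R)}(\boldsymbol k)=(2\pi)^{-d}\int_{\mathbb T^d}e^{-\mathbf i\langle\boldsymbol k,\boldsymbol\theta\rangle_{S_L}}F(\boldsymbol\theta)e^{-\mathbf i\langle\boldsymbol k,\boldsymbol\theta\rangle_{S_R}}d\boldsymbol\theta$; $T^{(S_L,S_R)}_{\boldsymbol n}(F)=[\widehat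 F^{(S_L,S_R)}(\alpha-\beta)]_{\alpha,\beta\in\Lambda_{\boldsymbol n}}$, $\Lambda_{\boldsymbol n}=\prod_\ell\{0,\dots,n_\ell-1\}$ in lexicographic order. *)

(* Defs.v *)
(* mathcomp-analysis (R : realType), complex numbers R[i]
   from mathcomp-real-closed. *)
From HB Require Import structures.
From mathcomp Require Import all_boot all_order all_algebra.
From mathcomp Require Import complex.
From mathcomp Require Import all_classical all_reals all_analysis.
Set Implicit Arguments. Unset Strict Implicit. Unset Printing Implicit Defensive.
Import Order.TTheory GRing.Theory Num.Theory.
Local Open Scope classical_set_scope.
Local Open Scope ring_scope.
Local Open Scope complex_scope.

Section Quaternions.
Variable R : realType.

(* A quaternion  z + w j  with z, w in C_i = R[i]. *)
Record quat := Quat { qz : R[i]; qw : R[i] }.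

(* (z1 + w1 j)(z2 + w2 j) = (z1 z2 - w1 conj(w2)) + (z1 w2 + w1 conj(z2)) j,
   using  j z = conj(z) j  and  j^2 = -1. *)
Definition qmul (a b : quat) : quat :=
  Quat (qz a * qz b - qw a * (qw b)^*) (qz a * qw b + qw a * (qz b)^*).

(* quaternion conjugate: conj(z + w j) = conj(z) - w j *)
Definition qconj (a : quat) : quat := Quat (qz a)^* (- qw a).

(* the complex number e^{i t}, viewed as a quaternion *)
Definition qexpi (t : R) : quat := Quat (cos t +i* sin t) 0.

Definition qscale (c : R) (a : quat) : quat :=
  Quat (c%:C * qz a) (c%:C * qw a).
End Quaternions.

Section Torus.
Variable R : realType.
Variable d : nat.

(* points of R^d, with the product (tuple) sigma-algebra *)
Notation pt := (d.-tuple R).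

Definition coord (x : pt) (l : 'I_d) : R := tnth x l.

Definition tneg (x : pt) : pt := [tuple of map (fun t => - t) x].

(* T^d = [-pi, pi)^d *)
Definition torus : set pt := [set x | forall l, - pi <= coord x l < pi].

(* mu is the d-dimensional Lebesgue measure: it gives every closed box its
   volume.  (Closed boxes form a pi-system generating the tuple
   sigma-algebra, so this characterizes mu uniquely.) *)
Definition is_lebesgue_tuple (mu : {measure set pt -> \bar R}) : Prop :=
  forall a b : pt, (forall l, coord a l <= coord b l) ->
    mu [set x | forall l, coord a l <= coord x l <= coord b l]
    = (\prod_(l < d) (coord b l - coord a l))%:E.

(* integral of a quaternion-valued function, componentwise on the four
   real components *)
Definition qintegral (mu : {measure set pt -> \bar R}) (D : set pt)
  (f : pt -> quat R) : quat R :=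
  Quat (Rintegral mu D (fun x => complex.Re (qz (f x))) +i*
        Rintegral mu D (fun x => complex.Im (qz (f x))))
       (Rintegral mu D (fun x => complex.Re (qw (f x))) +i*
        Rintegral mu D (fun x => complex.Im (qw (f x)))).

(* <k, theta>_S = sum_{j in S} k_j theta_j *)
Definition ipS (S : {set 'I_d}) (k : 'I_d -> int) (x : pt) : R :=
  \sum_(j in S) (k j)%:~R * coord x j.

(* quaternion matrix-valued function F = Z + W j *)
Definition qmatfun (s : nat) (Z W : pt -> 'M[R[i]]_s) (x : pt) (p q : 'I_s)
  : quat R := Quat (Z x p q) (W x p q).

(* sandwich Fourier coefficient  \hat F^{(SL,SR)}(k), entry (p,q) *)
Definition sandwich_coef (mu : {measure set pt -> \bar R}) (s : nat)
  (F : pt -> 'I_s -> 'I_s -> quat R) (SL SR : {set 'I_d})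
  (k : 'I_d -> int) (p q : 'I_s) : quat R :=
  qscale ((2 * pi) ^- d)
    (qintegral mu torus (fun x =>
       qmul (qmul (qexpi (- ipS SL k x)) (F x p q)) (qexpi (- ipS SR k x)))).

(* index set Lambda_n x {0..s-1} of the block matrix T_n(F) *)
Definition Lambda_idx (s : nat) (n : 'I_d -> nat) : set (('I_d -> nat) * 'I_s) :=
  [set ap | forall l, (ap.1 l < n l)%N].

(* block multilevel Toeplitz matrix  T_n^{(SL,SR)}(F): entry at row (alpha,p),
   column (beta,q) is  \hat F^{(SL,SR)}(alpha - beta)_{p q}.  Represented as a
   function on Lambda_idx n x Lambda_idx n (the order of the index set is
   irrelevant for Hermitianity). *)
Definition sandwich_toeplitz (mu : {measure set pt -> \bar R}) (s : nat)
  (F : pt -> 'I_s -> 'I_s -> quat R) (SL SR : {set 'I_d})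
  (a b : ('I_d -> nat) * 'I_s) : quat R :=
  sandwich_coef mu F SL SR (fun l => (a.1 l)%:Z - (b.1 l)%:Z) a.2 b.2.

(* a quaternion matrix X indexed by A is Hermitian: X = X^* *)
Definition qhermitian (I : Type) (A : set I) (X : I -> I -> quat R) : Prop :=
  forall a b, A a -> A b -> X a b = qconj (X b a).

(* condition (i) *)
Definition toeplitz_hermitian (mu : {measure set pt -> \bar R}) (s : nat)
  (F : pt -> 'I_s -> 'I_s -> quat R) (SL SR : {set 'I_d}) : Prop :=
  forall n : 'I_d -> nat,
    qhermitian (@Lambda_idx s n) (sandwich_toeplitz mu F SL SR).

(* Z in L^1(T^d; C^{s x s}) *)
Definition L1_cmat (mu : {measure set pt -> \bar R}) (s : nat)
  (Z : pt -> 'M[R[i]]_s) : Prop :=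
  forall p q : 'I_s,
    mu.-integrable torus (fun x => (complex.Re (Z x p q))%:E) /\
    mu.-integrable torus (fun x => (complex.Im (Z x p q))%:E).

(* ordered partition S_L \dot\cup S_R = {1..d} *)
Definition ordered_partition (SL SR : {set 'I_d}) : Prop :=
  SL :&: SR = finset.set0 /\ SL :|: SR = [set: 'I_d]%SET.
End Torus.

(* Main.v *)
Require Import Defs.
From HB Require Import structures.
From mathcomp Require Import all_boot all_order all_algebra.
From mathcomp Require Import complex.
From mathcomp Require Import all_classical all_reals all_analysis.
From mathcomp Require Import measurable_realfun.
From mathcomp Require Import ring lra.
Set Implicit Arguments.
Unset Strict Implicit.
Unset Printing Implicit Defensive.
Import Order.TTheory GRing.Theory Num.Theory.
Import numFieldNormedType.Exports.
Local Open Scope classical_set_scope.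
Local Open Scope ring_scope.
Local Open Scope complex_scope.

(** Sandwiching by exponentials turns the k-th coefficient of F = Z + W j into
    the Fourier coefficient of Z at k plus that of W at the frequency k with its
    entries in S_R negated.  Every k is a difference alpha - beta, so (i) says
    that the Fourier coefficients of Z_pq - conj Z_qp and of
    W_pq(x) + W_qp(-x) all vanish, and the frequency twist is a bijection of Z^d
    that does not affect this condition.  It remains to show that an integrable
    f with vanishing Fourier coefficients is zero almost everywhere.  Consider
    the measurable sets E such that multiplication by the indicator of E
    preserves the property of annihilating all trigonometric polynomials.  They
    form a sigma-algebra, which contains the sublevel sets of trigonometric
    polynomials because the indicator of y < 1/2 on [0, 1] is a bounded pointwise
    limit of polynomials; on (-pi, pi)^d these sets generate the Borel sets. *)

(** * Polynomial approximation of a step function on [0, 1] *)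

(* The exponent n 2^n makes these polynomials converge on [0, 1] to the indicator
   of y < 1/2, including at y = 1/2. *)
Definition step_poly (R : realType) (n : nat) (y : R) : R :=
  (1 - y ^+ n) ^+ (n * 2 ^ n).

Lemma step_poly_itv01 (R : realType) (n : nat) (y : R) : 0 <= y <= 1 ->
  0 <= step_poly n y <= 1.
Proof.
move=> /andP[y0 y1]; have yn1 : y ^+ n <= 1 by rewrite exprn_ile1.
rewrite /step_poly exprn_ge0 ?subr_ge0//= exprn_ile1 ?subr_ge0//.
by rewrite gerBl exprn_ge0.
Qed.

(** With [a = y ^+ n] and [N = n * 2 ^ n] one has N a = n (2 y)^n; this lower bound then pushes
    [step_poly] to 1 when y < 1/2. *)
Lemma bernoulli_ge (R : realType) (a : R) (N : nat) : 0 <= a <= 1 ->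
  1 - N%:R * a <= (1 - a) ^+ N.
Proof.
move=> /andP[a0 a1]; elim: N => [|N IH]; first by rewrite mul0r subr0 expr0.
rewrite exprS; have : (1 - a) * (1 - N%:R * a) <= (1 - a) * (1 - a) ^+ N.
  by rewrite ler_wpM2l// subr_ge0.
apply: le_trans; rewrite -natr1.
have := ler0n R N; nra.
Qed.

(** Follows by induction from (1 - a)(1 + (N + 1) a) <= 1 + N a; it is the companion upper bound,
    which pushes [step_poly] to 0 when y >= 1/2. *)
Lemma bernoulli_le (R : realType) (a : R) (N : nat) : 0 <= a <= 1 ->
  (1 - a) ^+ N * (1 + N%:R * a) <= 1.
Proof.
move=> /andP[a0 a1]; elim: N => [|N IH]; first by rewrite mul0r addr0 expr0 mulr1.
apply: le_trans IH; rewrite exprS -mulrA mulrCA ler_wpM2l//.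
  by rewrite exprn_ge0 ?subr_ge0.
rewrite -natr1.
have := ler0n R N; nra.
Qed.

(** Write r = s^2: one factor s^n absorbs n, since n s^n stays bounded by 1/(1 - s), and the other
    factor tends to 0. *)
Lemma cvg_natr_mul_expr (R : realType) (r : R) : 0 <= r < 1 ->
  n%:R * r ^+ n @[n --> \oo] --> 0.
Proof.
move=> /andP[r0 r1].
pose s := Num.sqrt r.
have s0 : 0 <= s by exact: sqrtr_ge0.
have s1 : s < 1 by rewrite -sqrtr1 ltr_sqrt.
have rs : r = s * s by rewrite -expr2 sqr_sqrtr.
have bnd n : n%:R * s ^+ n <= (1 - s)^-1.
  rewrite -[leRHS]mul1r ler_pdivlMr ?subr_gt0//.
  (* The extra term s^n makes the left side nonincreasing in n, with value 1 at n = 0. The bound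
     amounts to comparing n s^n with 1 + s + ... + s^(n-1). *)
  have : n%:R * s ^+ n * (1 - s) + s ^+ n <= 1.
    elim: n => [|n IH]; first by rewrite mul0r mul0r add0r expr0.
    apply: le_trans IH; rewrite exprS -natr1.
    have := ler0n R n; have : 0 <= s ^+ n by rewrite exprn_ge0.
    set q := s ^+ n; set m := n%:R; move=> q0 m0.
    have -> : (m + 1) * (s * q) * (1 - s) + s * q =
      m * q * (1 - s) + q - q * (1 - s) * (m * (1 - s) + (1 - s)) by ring.
    rewrite gerBl; apply: mulr_ge0; first by nra.
    by nra.
  have : 0 <= s ^+ n by rewrite exprn_ge0.
  by lra.
apply: (@squeeze_cvgr _ _ _ _ (fun=> 0) (fun n => (1 - s)^-1 * s ^+ n)).
- near=> n; rewrite mulr_ge0 ?exprn_ge0//=.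
  by rewrite rs exprMn mulrA ler_wpM2r// exprn_ge0.
- exact: cvg_cst.
- rewrite -[X in _ --> X](mulr0 ((1 - s)^-1)); apply: cvgM; first exact: cvg_cst.
  by apply: cvg_expr; rewrite ger0_norm.
Unshelve. all: by end_near. Qed.

Lemma step_poly_cvg (R : realType) (y : R) : 0 <= y <= 1 ->
  step_poly n y @[n --> \oo] --> ((y < 2^-1)%R%:R : R).
Proof.
move=> /andP[y0 y1].
have yn01 n : 0 <= y ^+ n <= 1 by rewrite exprn_ge0// exprn_ile1.
have [ylt|yge] /= := ltP y (2^-1).
- apply: (@squeeze_cvgr _ _ _ _ (fun n => 1 - n%:R * (2 * y) ^+ n) (fun=> 1)).
  + near=> n; apply/andP; split; last first.
      by have /andP[] := @step_poly_itv01 R n y (introT andP (conj y0 y1)).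
    apply: le_trans (bernoulli_ge (n * 2 ^ n) (yn01 n)).
    by rewrite natrM natrX exprMn mulrA.
  + rewrite -[X in _ --> X]subr0; apply: cvgB; first exact: cvg_cst.
    by apply: cvg_natr_mul_expr; lra.
  + exact: cvg_cst.
- apply: (@squeeze_cvgr _ _ _ _ (fun=> 0) (fun n => harmonic n)).
  + near=> n; apply/andP; split.
      by have /andP[] := @step_poly_itv01 R n y (introT andP (conj y0 y1)).
    rewrite /harmonic /= -[leRHS]mul1r ler_pdivlMr//.
    apply: le_trans (bernoulli_le (n * 2 ^ n) (yn01 n)).
    rewrite /step_poly ler_wpM2l ?exprn_ge0 ?subr_ge0//.
      by case/andP : (yn01 n).
    (* Here 2 y >= 1, so n (2 y)^n >= n, which gives the bound 1/(n + 1). *)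
    rewrite -natr1 addrC lerD2l natrM natrX -mulrA -exprMn ler_peMr//.
    by rewrite exprn_ege1//; lra.
  + exact: cvg_cst.
  + exact: cvg_harmonic.
Unshelve. all: by end_near. Qed.

(** * Integrable functions orthogonal to an algebra of bounded measurable functions *)

Section annihilator.
Context (disp : measure_display) (T : measurableType disp) (R : realType).
Variables (mu : {measure set T -> \bar R}) (D : set T) (mD : measurable D).
Variable A : set (T -> R).
Hypothesis A_cst : forall c : R, A (cst c).
Hypothesis AD : forall g h, A g -> A h -> A (fun x => g x + h x).
Hypothesis AM : forall g h, A g -> A h -> A (fun x => g x * h x).
Hypothesis A_meas : forall h, A h -> measurable_fun [set: T] h.
Hypothesis A_bnd : forall h, A h -> exists M, forall x, `|h x| <= M.

(** Integrability is included because the real integral is obtained by [fine], which turns an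
    infinite value into 0. *)
Definition annihilates (f : T -> R) : Prop :=
  mu.-integrable D (EFin \o f) /\
  forall h, A h -> \int[mu]_(x in D) (f x * h x) = 0.

Lemma integrable_mul_bounded (f g : T -> R) (M : R) :
  mu.-integrable D (EFin \o f) -> measurable_fun D g ->
  (forall x, D x -> `|g x| <= M) ->
  mu.-integrable D (EFin \o (fun x => f x * g x)).
Proof.
move=> fi mg gM; have := @integrableMl _ _ _ mu D mD (EFin \o f) g fi mg.
apply; exists M; split; first exact: num_real.
by move=> m Mm x Dx; apply: le_trans (gM _ Dx) (ltW Mm).
Qed.

Lemma annihilates_ext (f g : T -> R) : {in D, f =1 g} -> annihilates f ->
  annihilates g.
Proof.
move=> fg [fi fA]; split.
  by apply: eq_integrable fi => // x Dx; rewrite /= fg.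
by move=> h Ah; rewrite -(fA h Ah); apply: eq_Rintegral => x Dx; rewrite fg.
Qed.

Lemma annihilates_mul (f g : T -> R) : annihilates f -> A g ->
  annihilates (fun x => f x * g x).
Proof.
move=> [fi fA] Ag; split.
  have [M gM] := A_bnd Ag.
  apply: (@integrable_mul_bounded f g M) => //.
  by apply: measurable_funTS; exact: A_meas.
move=> h Ah; under eq_Rintegral do rewrite -mulrA.
by apply: (fA (fun x => g x * h x)); exact: AM.
Qed.

Lemma annihilatesB (f g : T -> R) : annihilates f -> annihilates g ->
  annihilates (fun x => f x - g x).
Proof.
move=> [fi fA] [gi gA]; split; first by have := integrableB mD fi gi.
move=> h Ah; under eq_Rintegral do rewrite mulrBl.
have [M hM] := A_bnd Ah.
have mh : measurable_fun D h by apply: measurable_funTS; exact: A_meas.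
rewrite RintegralB//; last 2 first.
- exact: (@integrable_mul_bounded f h M).
- exact: (@integrable_mul_bounded g h M).
by rewrite fA// gA// subrr.
Qed.

(** Dominated convergence: for a test function h bounded by M, the products f g_n h are dominated by
    M |f|, and all their integrals vanish. *)
Lemma annihilates_lim (f : T -> R) (g_ : nat -> T -> R) (g : T -> R) :
  mu.-integrable D (EFin \o f) ->
  (forall n, annihilates (fun x => f x * g_ n x)) ->
  (forall n, measurable_fun D (g_ n)) ->
  (forall n x, D x -> `|g_ n x| <= 1) ->
  (forall x, D x -> g_ n x @[n --> \oo] --> g x) ->
  annihilates (fun x => f x * g x).
Proof.
move=> fi fg_ mg_ g_1 g_g.
have mf : measurable_fun D f by apply/measurable_EFinP; exact: measurable_int fi.
have mg : measurable_fun D g.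
  apply/measurable_EFinP.
  apply: (@emeasurable_fun_cvg _ _ _ _ (fun n => EFin \o g_ n)) => //.
    by move=> n; apply/measurable_EFinP.
  by move=> x Dx; apply: cvg_EFin; [exact: nearW|exact: g_g].
have g1 x : D x -> `|g x| <= 1.
  move=> Dx; have /cvg_norm := g_g x Dx => gx.
  have <- := cvg_lim (@Rhausdorff R) gx; apply: limr_le.
    by apply/cvg_ex; eexists; exact: gx.
  by apply: nearW => n; exact: g_1.
split; first exact: (@integrable_mul_bounded f g 1).
move=> h Ah; have [M hM] := A_bnd Ah.
have mh : measurable_fun D h by apply: measurable_funTS; exact: A_meas.
have [|||||] := @dominated_convergence _ _ _ mu D mD
  (fun n x => (f x * g_ n x * h x)%:E) (fun x => (f x * g x * h x)%:E)
  (fun x => (`|f x| * M)%:E).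
- move=> n; apply/measurable_EFinP; apply: measurable_funM => //.
  exact: measurable_funM.
- apply/measurable_EFinP; apply: measurable_funM => //.
  exact: measurable_funM.
- apply: aeW => x Dx; apply: cvg_EFin; first exact: nearW.
  by apply: cvgM; [apply: cvgM; [exact: cvg_cst|exact: g_g]|exact: cvg_cst].
- by have := integrableZr mD M (integrable_abse fi).
- apply: aeW => x n Dx; rewrite abse_EFin lee_fin !normrM ler_pM//.
  by rewrite ler_piMr// g_1.
move=> _ _ cv; rewrite /Rintegral.
have <- := cvg_lim (@ereal_hausdorff R) cv.
rewrite (_ : [sequence _]_n = cst 0%E) ?lim_cst//.
apply/funext => n /=; have [fgi fgA] := fg_ n.
(* The extended integral is finite by integrability, so a zero real part means that it is itself
   zero. *)
have := fgA h Ah; rewrite /Rintegral => /eqP; rewrite fine_eq0; first by move/eqP.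
apply: integrable_fin_num => //.
exact: (@integrable_mul_bounded (fun x => f x * g_ n x) h M).
Qed.

(* The measurable sets whose indicator preserves annihilation.  They are stable
   under intersection by iteration, under complement by linearity and under
   countable union by dominated convergence, so no monotone class argument is
   needed. *)
Definition transparent_set (E : set T) : Prop :=
  measurable E /\
  forall f, annihilates f -> annihilates (fun x => f x * \1_E x).

(** All integrals are over D, so only the trace of a set on D matters. *)
Lemma transparent_set_ext (E F : set T) : measurable F ->
  (forall x, D x -> E x <-> F x) -> transparent_set E -> transparent_set F.
Proof.
move=> mF EF [mE tE]; split=> // f fa.
apply: annihilates_ext (tE f fa) => x; rewrite inE => Dx; rewrite !indicE.
have -> // : (x \in E) = (x \in F).
by apply/idP/idP; rewrite !inE => /(EF x Dx).
Qed.

Lemma transparent_setC (E : set T) : transparent_set E ->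
  transparent_set (~` E).
Proof.
move=> [mE tE]; split; first exact: measurableC.
move=> f fa; rewrite (_ : (fun _ => _) = (fun x => f x - f x * \1_E x)).
  by apply: annihilatesB => //; exact: tE.
apply/funext => x; rewrite !indicE in_setC.
by case: (x \in E) => /=; rewrite ?mulr0 ?mulr1 ?subr0 ?subrr.
Qed.

Lemma transparent_setI (E F : set T) : transparent_set E -> transparent_set F ->
  transparent_set (E `&` F).
Proof.
move=> [mE tE] [mF tF]; split; first exact: measurableI.
move=> f fa; rewrite (_ : (fun _ => _) = (fun x => f x * \1_E x * \1_F x)).
  by apply: tF; exact: tE.
by apply/funext => x; rewrite indicI /= mulrA.
Qed.

Lemma transparent_set0 : transparent_set set0.
Proof.
split=> // f [fi fA]; rewrite (_ : (fun _ => _) = (fun x => f x - f x)).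
  exact: annihilatesB.
by apply/funext => x; rewrite indicE in_set0 mulr0 subrr.
Qed.

Lemma transparent_setU (E F : set T) : transparent_set E -> transparent_set F ->
  transparent_set (E `|` F).
Proof.
move=> tE tF; rewrite -[E `|` F]setCK setCU.
by apply/transparent_setC/transparent_setI; exact: transparent_setC.
Qed.

Lemma transparent_bigcup (F : (set T)^nat) : (forall i, transparent_set (F i)) ->
  transparent_set (\bigcup_i F i).
Proof.
move=> tF; split; first by apply: bigcupT_measurable => i; case: (tF i).
have tU n : transparent_set (\big[setU/set0]_(i < n) F i).
  elim: n => [|n IH]; first by rewrite big_ord0; exact: transparent_set0.
  by rewrite big_ord_recr /=; exact: transparent_setU.
(* The indicators of the finite unions are eventually constant at each point. *)
move=> f fa; apply: (@annihilates_lim f (fun n => \1_(\big[setU/set0]_(i < n) F i))).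
- by case: fa.
- by move=> n; apply (tU n).2.
- by move=> n; apply: measurable_indic; case: (tU n).
- by move=> n x _; rewrite indicE; case: (_ \in _); rewrite ?normr1 ?normr0.
move=> x _; rewrite indicE.
have [|xF] := boolP (x \in \bigcup_i F i).
- rewrite inE => -[i _ Fix].
  apply: cvg_near_cst; near=> n; rewrite indicE mem_set//.
  rewrite -bigcup_mkord; exists i => //=.
  by near: n; exact: nbhs_infty_gt.
- apply: cvg_near_cst; apply: nearW => n; rewrite indicE memNset//.
  rewrite -bigcup_mkord => -[i _ Fix].
  by move/negP : xF; apply; rewrite inE; exists i.
Unshelve. all: by end_near. Qed.

Lemma algebra_expr (g : T -> R) n : A g -> A (fun x => g x ^+ n).
Proof.
move=> Ag; elim: n => [|n IH]; first by under eq_fun do rewrite expr0; exact: A_cst.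
by under eq_fun do rewrite exprS; exact: AM.
Qed.

(** An affine rescaling y of h takes values in [0, 1] and satisfies h < c exactly when y < 1/2. The
    functions [step_poly n (y x)] lie in the algebra and converge boundedly to the indicator. *)
Lemma transparent_lt (h : T -> R) (c : R) : A h ->
  transparent_set [set x | h x < c].
Proof.
move=> Ah; have [M hM] := A_bnd Ah; have mh := A_meas Ah.
have mE : measurable [set x | h x < c].
  by have := measurable_fun_ltr mh (measurable_cst c); move=> /(_ measurableT);
    move=> /(_ [set true] (Logic.I)); rewrite setTI.
split=> // f fa.
(* K / 2 bounds |h - c|, and the summand 1 keeps K positive. *)
pose K := 2 * (`|M| + `|c| + 1).
have K0 : 0 < K by rewrite /K; have := normr_ge0 M; have := normr_ge0 c; lra.
pose y x := 2^-1 + (h x - c) / K.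
have y01 x : 0 <= y x <= 1.
  have hx : `|h x - c| <= K * 2^-1.
    rewrite /K mulrC mulKf// (le_trans (ler_normB _ _))//.
    have := hM x; have := ler_norm M; lra.
  have : `|(h x - c) / K| <= 2^-1.
    by rewrite normrM normfV (gtr0_norm K0) ler_pdivrMr// mulrC.
  by rewrite ler_norml /y; lra.
have Ay : A y.
  apply: AD; first exact: A_cst.
  by apply: AM; [apply: AD => //; exact: (A_cst (- c))|exact: (A_cst K^-1)].
have Astep n : A (fun x => step_poly n (y x)).
  apply: (@algebra_expr (fun x => 1 - y x ^+ n)).
  apply: AD; first exact: A_cst.
  rewrite (_ : (fun _ => _) = (fun x => -1 * y x ^+ n)); last first.
    by apply/funext => x; rewrite mulN1r.
  by apply: AM; [exact: A_cst|exact: algebra_expr].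
apply: (@annihilates_lim f (fun n x => step_poly n (y x))).
- by case: fa.
- by move=> n; apply: annihilates_mul => //; exact: Astep.
- by move=> n; apply: measurable_funTS; apply: A_meas; exact: Astep.
- move=> n x _; have /andP[? ?] := step_poly_itv01 n (y01 x).
  by rewrite ger0_norm.
move=> x _; rewrite indicE.
have -> : (x \in [set x0 | h x0 < c]) = (y x < 2^-1).
  rewrite /y gtrDl pmulr_llt0 ?invr_gt0// subr_lt0.
  by apply/idP/idP; rewrite inE.
exact: step_poly_cvg.
Qed.

(** Multiplying f by the indicator of E preserves annihilation; then test against the constant 1. *)
Lemma annihilates_integral (f : T -> R) (E : set T) :
  annihilates f -> transparent_set E ->
  (\int[mu]_(x in D `&` E) (f x)%:E = 0)%E.
Proof.
move=> fa [mE /(_ _ fa)[fEi /(_ _ (A_cst 1))]] /=.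
under eq_Rintegral do rewrite mulr1.
rewrite /Rintegral => /eqP; rewrite fine_eq0; last exact: integrable_fin_num.
move=> /eqP; rewrite integral_mkcondr => <-.
apply: eq_integral => x _; rewrite restrict_EFin /= patchE indicE.
by case: (x \in E); rewrite ?mulr1 ?mulr0.
Qed.

End annihilator.

(** * The algebra of real trigonometric polynomials *)

Section trig.
Variables (R : realType) (d : nat).
Local Notation pt := (d.-tuple R).
Local Notation coord := (@Defs.coord R d).
Implicit Types (k m : 'I_d -> int) (x : pt).

Definition ip k x : R := ipS [set: 'I_d]%SET k x.

Lemma ipE k x : ip k x = \sum_(l < d) (k l)%:~R * coord x l.
Proof. by rewrite /ip /ipS; apply: eq_bigl => l; rewrite finset.in_setT. Qed.

Lemma ipD k m x : ip (fun l => k l + m l) x = ip k x + ip m x.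
Proof.
by rewrite !ipE -big_split; apply: eq_bigr => l _; rewrite intrD mulrDl.
Qed.

Lemma ipN k x : ip (fun l => - k l) x = - ip k x.
Proof. by rewrite !ipE -sumrN; apply: eq_bigr => l _; rewrite mulrNz mulNr. Qed.

Lemma ip0 x : ip (fun=> 0) x = 0.
Proof. by rewrite ipE big1// => l _; rewrite mulr0z mul0r. Qed.

Lemma ip_delta (l : 'I_d) x : ip (fun j => (j == l)%:Z) x = coord x l.
Proof.
rewrite ipE (bigD1 l)//= eqxx mulr1z mul1r big1 ?addr0// => j /negbTE ->.
by rewrite mulr0z mul0r.
Qed.

Lemma coord_tneg x l : coord (tneg x) l = - coord x l.
Proof. by rewrite /coord /tneg tnth_map. Qed.

Lemma ip_tneg k x : ip k (tneg x) = - ip k x.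
Proof.
by rewrite !ipE -sumrN; apply: eq_bigr => l _; rewrite coord_tneg mulrN.
Qed.

Lemma measurable_coord l : measurable_fun [set: pt] (fun x => coord x l).
Proof. exact: measurable_tnth. Qed.

Lemma measurable_ip k : measurable_fun [set: pt] (ip k).
Proof.
rewrite (_ : ip k = fun x => \sum_(l < d) (k l)%:~R * coord x l); last first.
  by apply/funext => x; rewrite ipE.
apply: measurable_sum => l; apply: measurable_funM; first exact: measurable_cst.
exact: measurable_coord.
Qed.

Lemma measurable_cos_ip k : measurable_fun [set: pt] (fun x => cos (ip k x)).
Proof.
apply: (measurableT_comp _ (measurable_ip k)).
apply: continuous_measurable_fun; exact: continuous_cos.
Qed.

Lemma measurable_sin_ip k : measurable_fun [set: pt] (fun x => sin (ip k x)).
Proof.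
apply: (measurableT_comp _ (measurable_ip k)).
apply: continuous_measurable_fun; exact: continuous_sin.
Qed.

Lemma norm_cos_le1 (t : R) : `|cos t| <= 1.
Proof. by rewrite ler_norml cos_geN1 cos_le1. Qed.

Lemma norm_sin_le1 (t : R) : `|sin t| <= 1.
Proof. by rewrite ler_norml sin_geN1 sin_le1. Qed.

(** Only linear operations are constructors, so that vanishing Fourier coefficients give
    annihilation by a direct induction. *)
Inductive trig_poly : (pt -> R) -> Prop :=
| trig_cos k : trig_poly (fun x => cos (ip k x))
| trig_sin k : trig_poly (fun x => sin (ip k x))
| trigD g h : trig_poly g -> trig_poly h -> trig_poly (fun x => g x + h x)
| trigZ c g : trig_poly g -> trig_poly (fun x => c * g x).

Lemma trig_ext g h : g =1 h -> trig_poly g -> trig_poly h.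
Proof. by move=> /funext ->. Qed.

Lemma trig_cst c : trig_poly (cst c).
Proof.
apply: (trig_ext _ (trigZ c (trig_cos (fun=> 0)))) => x /=.
by rewrite ip0 cos0 mulr1.
Qed.

(** Bilinearity reduces the claim to pairs of generators, where the product-to-sum formulas involve
    the frequencies k + m and k - m. *)
Lemma trigM g h : trig_poly g -> trig_poly h -> trig_poly (fun x => g x * h x).
Proof.
move=> tg; elim: tg h => {g} [k|k|g1 g2 _ IH1 _ IH2|c g _ IH] h th; first last.
- apply: (trig_ext _ (trigZ c (IH _ th))) => x /=; exact: mulrA.
- apply: (trig_ext _ (trigD (IH1 _ th) (IH2 _ th))) => x /=; by rewrite mulrDl.
- elim: th => {h} [m|m|g1 g2 _ IH1 _ IH2|c g _ IH].
  + apply: (trig_ext _ (trigD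
     (trigZ 2^-1 (trig_sin (fun l => k l + m l)))
     (trigZ 2^-1 (trig_sin (fun l => k l + - m l))))) => x /=.
    by rewrite (ipD k m) (ipD k (fun l => - m l)) ipN !sinD cosN sinN; field.
  + apply: (trig_ext _ (trigD
     (trigZ (- 2^-1) (trig_cos (fun l => k l + m l)))
     (trigZ 2^-1 (trig_cos (fun l => k l + - m l))))) => x /=.
    by rewrite (ipD k m) (ipD k (fun l => - m l)) ipN !cosD cosN sinN; field.
  + apply: (trig_ext _ (trigD IH1 IH2)) => x /=; by rewrite mulrDr.
  + apply: (trig_ext _ (trigZ c IH)) => x /=; by rewrite mulrCA.
- elim: th => {h} [m|m|g1 g2 _ IH1 _ IH2|c g _ IH].
  + apply: (trig_ext _ (trigD
     (trigZ 2^-1 (trig_cos (fun l => k l + m l)))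
     (trigZ 2^-1 (trig_cos (fun l => k l + - m l))))) => x /=.
    by rewrite (ipD k m) (ipD k (fun l => - m l)) ipN !cosD cosN sinN; field.
  + apply: (trig_ext _ (trigD
     (trigZ 2^-1 (trig_sin (fun l => k l + m l)))
     (trigZ (- 2^-1) (trig_sin (fun l => k l + - m l))))) => x /=.
    by rewrite (ipD k m) (ipD k (fun l => - m l)) ipN !sinD cosN sinN; field.
  + apply: (trig_ext _ (trigD IH1 IH2)) => x /=; by rewrite mulrDr.
  + apply: (trig_ext _ (trigZ c IH)) => x /=; by rewrite mulrCA.
Qed.

Lemma trig_meas g : trig_poly g -> measurable_fun [set: pt] g.
Proof.
elim=> {g} [k|k|g h _ mg _ mh|c g _ mg].
- exact: measurable_cos_ip.
- exact: measurable_sin_ip.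
- exact: measurable_funD.
- by apply: measurable_funM => //; exact: measurable_cst.
Qed.

Lemma trig_bnd g : trig_poly g -> exists M, forall x, `|g x| <= M.
Proof.
elim=> {g} [k|k|g h _ [M gM] _ [N hN]|c g _ [M gM]].
- by exists 1 => x; exact: norm_cos_le1.
- by exists 1 => x; exact: norm_sin_le1.
- by exists (M + N) => x; rewrite (le_trans (ler_normD _ _))// lerD.
- by exists (`|c| * M) => x; rewrite normrM ler_wpM2l.
Qed.

Lemma measurable_coord_itv l (i : interval R) :
  measurable [set x : pt | coord x l \in i].
Proof.
rewrite -[X in measurable X]setTI.
exact: (@measurable_coord l measurableT _ (measurable_itv i)).
Qed.

Lemma measurable_forall_coord (P : 'I_d -> set pt) :
  (forall l, measurable (P l)) -> measurable [set x | forall l, P l x].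
Proof.
move=> mP; rewrite (_ : [set _ | _] = \bigcap_(l in [set: 'I_d]) P l).
  by apply: fin_bigcap_measurable.
by apply/seteqP; split => x Px l; [move=> _|]; exact: Px.
Qed.

(** Unlike the half-open torus, the open cube is stable under x -> -x. *)
Definition cube : set pt := [set x | forall l, - pi < coord x l < pi].

Lemma measurable_cube : measurable cube.
Proof.
apply: (@measurable_forall_coord (fun l => [set x | - pi < coord x l < pi])).
by move=> l; have := @measurable_coord_itv l `]- pi, pi[; under eq_set do
  rewrite in_itv.
Qed.

Lemma measurable_torus : measurable (@torus R d).
Proof.
apply: (@measurable_forall_coord (fun l => [set x | - pi <= coord x l < pi])).
by move=> l; have := @measurable_coord_itv l `[- pi, pi[; under eq_set do
  rewrite in_itv.
Qed.

(** * Uniqueness of Fourier coefficients of integrable functions *)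

Section unique.
Variable mu : {measure set pt -> \bar R}.

Let transparent := transparent_set mu cube trig_poly.

Let tlt h c : trig_poly h -> transparent [set x | h x < c].
Proof.
exact: (transparent_lt mu measurable_cube trig_cst (@trigD) (@trigM) (@trig_meas)
  (@trig_bnd)).
Qed.

Let tC E : transparent E -> transparent (~` E).
Proof. exact: (transparent_setC measurable_cube (@trig_meas) (@trig_bnd)). Qed.

Let tI E F : transparent E -> transparent F -> transparent (E `&` F).
Proof. exact: transparent_setI. Qed.

Let t0 : transparent set0.
Proof. exact: (transparent_set0 mu measurable_cube (@trig_meas) (@trig_bnd)). Qed.

Let tU (F : (set pt)^nat) : (forall i, transparent (F i)) ->
  transparent (\bigcup_i F i).
Proof. exact: (transparent_bigcup measurable_cube (@trig_meas) (@trig_bnd)). Qed.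

(* On (-pi, pi), the sign of sin separates the two halves and cos is injective
   on each of them, so the rays in each coordinate are recovered from sublevel
   sets of trigonometric polynomials. *)
Lemma transparent_ray l (c : R) : transparent [set x | c <= coord x l].
Proof.
have mray : measurable [set x : pt | c <= coord x l].
  by have := @measurable_coord_itv l `[c, +oo[; under eq_set do
    rewrite in_itv /= andbT.
pose S := [set x : pt | sin (ip (fun j => (j == l)%:Z) x) < 0].
have tS : transparent S by apply: tlt; exact: trig_sin.
have tcos : transparent [set x | cos (ip (fun j => (j == l)%:Z) x) < cos c].
  by apply: tlt; exact: trig_cos.
have tNcos :
    transparent [set x | -1 * cos (ip (fun j => (j == l)%:Z) x) < - cos c].
  by apply: (tlt (h := fun x => -1 * _)); apply: trigZ; exact: trig_cos.
have SE x : cube x -> S x <-> coord x l < 0.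
  move=> /(_ l) /andP[x1 x2]; rewrite /S /= ip_delta.
  have [x0|x0|->] := ltgtP (coord x l) 0.
  - split=> // _; rewrite -oppr_gt0 -sinN; apply: sin_gt0_pi.
    by rewrite oppr_gt0 x0 ltrNl.
  - split=> //; apply: contraTT => _; rewrite -leNgt ltW//.
    by apply: sin_gt0_pi; rewrite x0.
  - by rewrite sin0 ltxx.
(* For c outside (-pi, pi) the ray meets the cube in nothing or in the whole cube. *)
have [cpi|cpi] := leP pi c.
  apply: (transparent_set_ext measurable_cube mray _ t0) => x /(_ l) /andP[_ xpi].
  by split=> //= cx; have := lt_le_trans xpi (le_trans cpi cx); rewrite ltxx.
have [cNpi|cNpi] := leP c (- pi).
  apply: (transparent_set_ext measurable_cube mray _ (tC t0)) => x /(_ l) /andP[xpi _].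
  by split=> [_|_ []] //=; rewrite (le_trans cNpi)// ltW.
(* For 0 <= c < pi the ray is given by sin >= 0 and cos <= cos c, because cos decreases on
   [0, pi]. *)
have [c0|c0] := leP 0 c.
  apply: (transparent_set_ext measurable_cube mray _ (tI (tC tS) (tC tNcos))).
  move=> x Qx; have := SE x Qx; have /andP[x1 x2] := Qx l.
  move=> Sx; rewrite /setC /setI /= (ip_delta l x) mulN1r ltrN2.
  have cosE : 0 <= coord x l -> (cos c < cos (coord x l)) = (coord x l < c).
    by move=> x0; rewrite ltr_cos// in_itv/= ?x0 ?c0 ltW.
  split.
  + move=> [nS ncos]; have x0 : 0 <= coord x l.
      by rewrite leNgt; apply/negP => /Sx.
    by rewrite leNgt -cosE//; apply/negP.
  + move=> cx; have x0 := le_trans c0 cx; split.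
      by move=> /Sx; rewrite ltNge x0.
    by rewrite cosE// ltNge cx.
(* For -pi < c < 0 the complement of the ray is given by sin < 0 and cos < cos c, because cos
   increases on [-pi, 0]. *)
apply: (transparent_set_ext measurable_cube mray _ (tC (tI tS tcos))).
move=> x Qx; have := SE x Qx; have /andP[x1 x2] := Qx l.
move=> Sx; rewrite /setC /setI /= (ip_delta l x).
have cosE : coord x l < 0 -> (cos (coord x l) < cos c) = (coord x l < c).
  move=> x0; rewrite -cosN -[cos c]cosN ltr_cos ?ltrN2// in_itv/=.
    by rewrite oppr_ge0 lerNl !ltW.
  by rewrite oppr_ge0 lerNl !ltW.
split.
- move=> nSc; rewrite leNgt; apply/negP => xc; apply: nSc.
  have x0 := lt_trans xc c0; split; first exact/Sx.
  by rewrite cosE.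
- by move=> cx [/Sx x0]; rewrite cosE// ltNge cx.
Qed.

(** Transparent sets form a sigma-algebra. Preimages under coordinates generate the measurable sets
    of tuples, and the rays [c, +oo[ generate those of the line, so [transparent_ray] suffices. *)
Lemma transparent_measurable (E : set pt) : measurable E -> transparent E.
Proof.
suff tcoord l (B : set R) : measurable B -> transparent [set x | B (coord x l)].
  apply: smallest_sub.
    by split=> //; move=> F tF; rewrite setTD; exact: tC.
  rewrite -bigcup_seq; apply: bigcup_sub => l _ _ [B mB <-].
  by rewrite setTI; exact: tcoord.
move=> mB; have : (@RGenCInfty.G R).-sigma.-measurable B.
  by rewrite -RGenCInfty.measurableE.
move: B {mB}; apply: smallest_sub.
  split.
  - exact: t0.
  - by move=> B tB; rewrite setTD; exact: (tC tB).
  - by move=> F tF; exact: (tU tF).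
move=> _ [c ->]; rewrite (_ : [set x | _] = [set x | c <= coord x l]).
  exact: transparent_ray.
by apply/seteqP; split => x /=; rewrite in_itv /= andbT.
Qed.

(** By linearity f annihilates every trigonometric polynomial. As every measurable set is
    transparent, f has integral zero over each measurable subset of the cube, hence vanishes almost
    everywhere. *)
Lemma fourier_unique (f : pt -> R) :
  mu.-integrable cube (EFin \o f) ->
  (forall k, \int[mu]_(x in cube) (f x * cos (ip k x)) = 0) ->
  (forall k, \int[mu]_(x in cube) (f x * sin (ip k x)) = 0) ->
  {ae mu, forall x, cube x -> f x = 0}.
Proof.
move=> fi fcos fsin.
have mQ := measurable_cube.
have fa : annihilates mu cube trig_poly f.
  split=> // h; elim=> {h} [k|k|g h tg g0 th h0|c g tg g0].
  - exact: fcos.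
  - exact: fsin.
  - under eq_Rintegral do rewrite mulrDr.
    have [M gM] := trig_bnd tg; have [N hN] := trig_bnd th.
    rewrite RintegralD ?g0 ?h0 ?addr0//.
    + apply: (integrable_mul_bounded mQ fi (M := M)) => //.
      by apply: measurable_funTS; exact: trig_meas.
    + apply: (integrable_mul_bounded mQ fi (M := N)) => //.
      by apply: measurable_funTS; exact: trig_meas.
  - under eq_Rintegral do rewrite mulrCA.
    have [M gM] := trig_bnd tg.
    rewrite RintegralZl ?g0 ?mulr0//.
    apply: (integrable_mul_bounded mQ fi (M := M)) => //.
    by apply: measurable_funTS; exact: trig_meas.
have : ae_eq mu cube (EFin \o f) (cst 0%E).
  apply: integral_ae_eq => // E EQ mE; rewrite integral0.
  rewrite -(setIidr EQ); apply: (annihilates_integral mQ trig_cst fa).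
  exact: transparent_measurable.
by apply: filterS => x fx Qx; have [] := fx Qx.
Qed.

End unique.
End trig.

(** * Lebesgue measure: invariance under reflection and negligible faces of the torus *)

Section lebesgue_tuple.
Variables (R : realType) (d : nat).
Local Notation pt := (d.-tuple R).
Local Notation coord := (@Defs.coord R d).
Local Notation cube := (@cube R d).

Definition box (a b : pt) : set pt :=
  [set x | forall l, coord a l <= coord x l <= coord b l].

Definition boxes : set (set pt) := [set B | exists a b, B = box a b].

Lemma coord_mktuple (F : 'I_d -> R) l : coord [tuple F j | j < d] l = F l.
Proof. by rewrite /Defs.coord tnth_mktuple. Qed.

Lemma measurable_box a b : measurable (box a b).
Proof.
apply: (@measurable_forall_coord R d
  (fun l => [set x | coord a l <= coord x l <= coord b l])) => l.
by have := @measurable_coord_itv R d l `[coord a l, coord b l]; under eq_set do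
  rewrite in_itv.
Qed.

Lemma boxes_setI : setI_closed boxes.
Proof.
move=> _ _ [a [b ->]] [a' [b' ->]].
exists [tuple Num.max (coord a l) (coord a' l) | l < d],
  [tuple Num.min (coord b l) (coord b' l) | l < d].
apply/seteqP; split => x.
- move=> [xab xab'] l; rewrite !coord_mktuple ge_max le_min.
  by have /andP[-> ->] := xab l; have /andP[-> ->] := xab' l.
- move=> H; split=> l; have := H l; rewrite !coord_mktuple ge_max le_min;
  by move=> /andP[/andP[? ?] /andP[? ?]]; apply/andP.
Qed.

(** An exhaustion of the space by boxes of finite measure, as needed for uniqueness of measures. *)
Definition bigbox (n : nat) : set pt :=
  box [tuple - n%:R | l < d] [tuple n%:R | l < d].

Lemma bigbox_absorb (x : pt) :
  exists n : nat, forall l, - n%:R <= coord x l <= n%:R.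
Proof.
exists (Num.trunc (\sum_(l < d) `|coord x l|)).+1 => l.
rewrite -ler_norml; apply: le_trans (ltW (truncnS_gt _)).
by rewrite (bigD1 l)//= lerDl sumr_ge0.
Qed.

Lemma boxes_generate : @measurable _ pt = <<s boxes >>.
Proof.
apply/seteqP; split; last first.
  apply: smallest_sub; first exact: sigma_algebra_measurable.
  by move=> _ [a [b ->]]; exact: measurable_box.
have gC E : <<s boxes >> E -> <<s boxes >> (~` E).
  by move=> gE; rewrite -setTD; exact: sigma_algebraCD.
suff gcoord l (B : set R) : measurable B -> <<s boxes >> [set x | B (coord x l)].
  apply: smallest_sub; first exact: smallest_sigma_algebra.
  rewrite -bigcup_seq; apply: bigcup_sub => l _ _ [B mB <-].
  by rewrite setTI; exact: gcoord.
move=> mB; have : (@RGenCInfty.G R).-sigma.-measurable B.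
  by rewrite -RGenCInfty.measurableE.
move: B {mB}; apply: smallest_sub.
  split.
  - exact: sigma_algebra0.
  - by move=> B gB; rewrite setTD; exact: (gC _ gB).
  - by move=> F gF; exact: (sigma_algebra_bigcup gF).
move=> _ [c ->].
(* The half-space is exhausted by boxes whose side l starts at c; those with n < c are empty. *)
rewrite (_ : [set x | _] = \bigcup_n
  box [tuple (if j == l then c else - n%:R) | j < d] [tuple n%:R | j < d]).
  by apply: sigma_algebra_bigcup => n; apply: sub_sigma_algebra; do 2 eexists.
apply/seteqP; split => x /=; rewrite in_itv /= andbT.
- move=> cx; have [n xn] := bigbox_absorb x; exists n => // j.
  by rewrite !coord_mktuple; have /andP[? ->] := xn j; case: eqP => [->|_];
    rewrite andbT.
- by move=> [n _ /(_ l)]; rewrite !coord_mktuple eqxx => /andP[].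
Qed.

Lemma measurable_tneg : measurable_fun [set: pt] (@tneg R d).
Proof.
apply/measurable_fun_tnthP => l.
rewrite (_ : _ \o _ = fun x => - coord x l); last first.
  by apply/funext => x /=; rewrite -coord_tneg.
by apply: measurableT_comp => //; exact: measurable_coord.
Qed.

Lemma preimage_tneg_box a b : @tneg R d @^-1` box a b = box (tneg b) (tneg a).
Proof.
by apply/seteqP; split => x H l; have := H l; rewrite !coord_tneg;
  move=> /andP[? ?]; apply/andP; split; lra.
Qed.

Lemma preimage_tneg_cube : @tneg R d @^-1` cube = cube.
Proof.
by apply/seteqP; split => x H l; have := H l; rewrite !coord_tneg;
  move=> /andP[? ?]; apply/andP; split; lra.
Qed.

Section lebesgue.
Variable mu : {measure set pt -> \bar R}.
Hypothesis mu_leb : is_lebesgue_tuple mu.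

Lemma mu_box_empty a b l : coord b l < coord a l -> mu (box a b) = 0%E.
Proof.
move=> ba; rewrite (_ : box a b = set0) ?measure0//.
apply/seteqP; split => x // /(_ l) /andP[ax xb].
by have := lt_le_trans ba (le_trans ax xb); rewrite ltxx.
Qed.

Lemma mu_box_tneg a b : mu (box (tneg b) (tneg a)) = mu (box a b).
Proof.
have [ab|/existsNP[l /negP]] := pselect (forall l, coord a l <= coord b l).
  rewrite !mu_leb//; last by move=> l; rewrite !coord_tneg lerN2.
  congr (_%:E); apply: eq_bigr => l _.
  by rewrite !coord_tneg opprK addrC.
rewrite -ltNge => ba; rewrite (mu_box_empty ba) (@mu_box_empty _ _ l)//.
by rewrite !coord_tneg ltrN2.
Qed.

(** The measure and its pushforward by the reflection agree on boxes, a generating pi-system with an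
    exhaustion of finite measure, hence they agree everywhere. *)
Lemma mu_tneg (E : set pt) : measurable E -> mu (@tneg R d @^-1` E) = mu E.
Proof.
move=> mE; apply/esym; move: E mE.
unshelve eapply (@measure_unique _ _ _ boxes bigbox boxes_generate boxes_setI _ _
  mu (measure_function_pushforward__canonical__measure_function_Measure
   mu measurable_tneg)).
- by move=> n; do 2 eexists.
- apply/seteqP; split => // x _; have [n xn] := bigbox_absorb x.
  by exists n => // l; rewrite !coord_mktuple.
- by move=> _ [a [b ->]]; rewrite /= /pushforward preimage_tneg_box mu_box_tneg.
- move=> n; rewrite mu_leb ?ltry// => l; rewrite !coord_mktuple.
  by rewrite lerNl (le_trans _ (ler0n _ n))// oppr_le0.
Qed.

Lemma integral_tneg_ge0 (f : pt -> \bar R) : measurable_fun cube f ->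
  (forall x, 0 <= f x)%E ->
  (\int[mu]_(x in cube) f (tneg x) = \int[mu]_(x in cube) f x)%E.
Proof.
move=> mf f0; have mQ := @measurable_cube R d.
rewrite -{1}preimage_tneg_cube.
rewrite -(@ge0_integral_pushforward _ _ _ _ _ _ measurable_tneg mu cube f)//.
apply: eq_measure_integral; first exact: measurable_tneg.
by move=> ? A mA _; exact: mu_tneg.
Qed.

Lemma measurable_fun_tneg (f : pt -> \bar R) : measurable_fun cube f ->
  measurable_fun cube (f \o @tneg R d).
Proof.
move=> mf; have mQ := @measurable_cube R d.
apply: (measurable_comp mQ _ mf) => [_ [x Qx <-]|].
  by move: Qx; rewrite -{1}preimage_tneg_cube.
by apply: measurable_funTS; exact: measurable_tneg.
Qed.

Lemma integrable_tneg (f : pt -> \bar R) : mu.-integrable cube f ->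
  mu.-integrable cube (f \o @tneg R d).
Proof.
move=> /integrableP[mf fi]; apply/integrableP; split.
  exact: measurable_fun_tneg.
rewrite /= (@integral_tneg_ge0 (fun x => `|f x|%E))//.
exact: measurableT_comp.
Qed.

Lemma integral_tneg (f : pt -> \bar R) : mu.-integrable cube f ->
  (\int[mu]_(x in cube) f (tneg x) = \int[mu]_(x in cube) f x)%E.
Proof.
move=> fi; have mf := measurable_int _ fi.
rewrite integralE [RHS]integralE.
rewrite -(@integral_tneg_ge0 (f^\+)%E)//; last exact: measurable_funepos.
rewrite -(@integral_tneg_ge0 (f^\-)%E)//; last exact: measurable_funeneg.
by rewrite (funepos_comp f (@tneg R d)) (funeneg_comp f (@tneg R d)).
Qed.

Lemma Rintegral_tneg (f : pt -> R) : mu.-integrable cube (EFin \o f) ->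
  \int[mu]_(x in cube) f (tneg x) = \int[mu]_(x in cube) f x.
Proof. by move=> fi; rewrite /Rintegral (integral_tneg fi). Qed.

Lemma cube_torus : cube `<=` @torus R d.
Proof. by move=> x Qx l; have /andP[/ltW -> ->] := Qx l. Qed.

(** The points of the torus outside the cube lie on the d faces where a coordinate equals -pi. *)
Lemma ae_torus_cube : {ae mu, forall x, torus x -> cube x}.
Proof.
have pi0 := pi_ge0 R.
have : {ae mu, forall x, forall l, torus x -> coord x l != - pi}.
  apply: filter_forall => l.
  pose a : pt := [tuple - pi | j < d].
  (* The closed face is a box whose side l has length zero, so its volume is zero. *)
  pose b : pt := [tuple (if j == l then - pi else pi) | j < d].
  exists (box a b); split; first exact: measurable_box.
    rewrite mu_leb => [|j]; last first.
      by rewrite !coord_mktuple; case: eqP => // _; lra.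
    congr (_%:E); rewrite (bigD1 l)//= !coord_mktuple eqxx subrr.
    by rewrite mul0r.
  move=> x /= /not_implyP[Tx /negP/negPn/eqP xl] j; rewrite !coord_mktuple.
  have /andP[-> xpi] := Tx j; case: eqP => [->|_] /=; first by rewrite xl.
  exact: ltW.
apply: filterS => x H Tx l; have /andP[x1 ->] := Tx l; rewrite andbT.
by rewrite lt_neqAle x1 eq_sym H.
Qed.

Lemma Rintegral_torus (f : pt -> R) : mu.-integrable (@torus R d) (EFin \o f) ->
  \int[mu]_(x in @torus R d) f x = \int[mu]_(x in cube) f x.
Proof.
move=> fi; have mQ := @measurable_cube R d; have mT := @measurable_torus R d.
have mN : measurable (@torus R d `\` cube) by exact: measurableD.
rewrite /Rintegral (negligible_integral mN mT fi).
  by rewrite setDD (setIidr cube_torus).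
apply: measure_negligible => //; apply: negligibleS ae_torus_cube.
by move=> x [Tx nQx] /= H; exact/nQx/H.
Qed.

End lebesgue.
End lebesgue_tuple.

(** * Symmetries of functions read off their Fourier coefficients *)

Section fourier.
Variables (R : realType) (d : nat).
Local Notation pt := (d.-tuple R).
Local Notation cube := (@cube R d).
Local Notation torus := (@torus R d).
Implicit Types (k : 'I_d -> int) (a b : pt -> R).

(** Both exponentials commute with z and combine to e^{-i(s+t)}. Moving the right one past j
    conjugates it, so w receives e^{-i(s-t)}. *)
Lemma qmul_sandwich (s t : R) (z w : R[i]) :
  qmul (qmul (qexpi (- s)) (Quat z w)) (qexpi (- t)) =
  Quat ((complex.Re z * cos (s + t) + complex.Im z * sin (s + t)) +i*
        (complex.Im z * cos (s + t) - complex.Re z * sin (s + t)))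
       ((complex.Re w * cos (s - t) + complex.Im w * sin (s - t)) +i*
        (complex.Im w * cos (s - t) - complex.Re w * sin (s - t))).
Proof.
case: z w => [zr zi] [wr wi]; rewrite /qmul /qexpi /=.
by congr Quat; apply/eqP; rewrite eq_complex /=; apply/andP; split; apply/eqP;
  rewrite !(cosD, sinD, cosN, sinN); ring.
Qed.

Variable mu : {measure set pt -> \bar R}.
Hypothesis mu_leb : is_lebesgue_tuple mu.

(* Real and imaginary parts of the integral of (a + i b) e^{-i<k,x>}. *)
Definition fourier_re a b k : R :=
  \int[mu]_(x in cube) (a x * cos (ip k x) + b x * sin (ip k x)).
Definition fourier_im a b k : R :=
  \int[mu]_(x in cube) (b x * cos (ip k x) - a x * sin (ip k x)).

Let intq a := mu.-integrable cube (EFin \o a).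

Lemma integrable_mul_cos (D : set pt) a k : measurable D ->
  mu.-integrable D (EFin \o a) ->
  mu.-integrable D (EFin \o (fun x => a x * cos (ip k x))).
Proof.
move=> mD ai; apply: (integrable_mul_bounded mD ai (M := 1)).
  by apply: measurable_funTS; exact: measurable_cos_ip.
by move=> x _; exact: norm_cos_le1.
Qed.

Lemma integrable_mul_sin (D : set pt) a k : measurable D ->
  mu.-integrable D (EFin \o a) ->
  mu.-integrable D (EFin \o (fun x => a x * sin (ip k x))).
Proof.
move=> mD ai; apply: (integrable_mul_bounded mD ai (M := 1)).
  by apply: measurable_funTS; exact: measurable_sin_ip.
by move=> x _; exact: norm_sin_le1.
Qed.

Let ccos a k := \int[mu]_(x in cube) (a x * cos (ip k x)).
Let csin a k := \int[mu]_(x in cube) (a x * sin (ip k x)).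

Lemma fourier_reE a b k : intq a -> intq b ->
  fourier_re a b k = ccos a k + csin b k.
Proof.
move=> ai bi; have mQ := @measurable_cube R d.
by apply: RintegralD => //; [exact: integrable_mul_cos|exact: integrable_mul_sin].
Qed.

Lemma fourier_imE a b k : intq a -> intq b ->
  fourier_im a b k = ccos b k - csin a k.
Proof.
move=> ai bi; have mQ := @measurable_cube R d.
by apply: RintegralB => //; [exact: integrable_mul_cos|exact: integrable_mul_sin].
Qed.

Lemma ccosN a k : ccos a (fun l => - k l) = ccos a k.
Proof. by apply: eq_Rintegral => x _; rewrite ipN cosN. Qed.

Lemma csinN a k : intq a -> csin a (fun l => - k l) = - csin a k.
Proof.
move=> ai; have mQ := @measurable_cube R d.
rewrite -mulN1r -RintegralZl//; last exact: integrable_mul_sin.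
by apply: eq_Rintegral => x _; rewrite ipN sinN mulrN mulN1r.
Qed.

Lemma ccosD a b k : intq a -> intq b ->
  ccos (fun x => a x + b x) k = ccos a k + ccos b k.
Proof.
move=> ai bi; have mQ := @measurable_cube R d.
rewrite -RintegralD//; do ?exact: integrable_mul_cos.
by apply: eq_Rintegral => x _; rewrite mulrDl.
Qed.

Lemma csinD a b k : intq a -> intq b ->
  csin (fun x => a x + b x) k = csin a k + csin b k.
Proof.
move=> ai bi; have mQ := @measurable_cube R d.
rewrite -RintegralD//; do ?exact: integrable_mul_sin.
by apply: eq_Rintegral => x _; rewrite mulrDl.
Qed.

Lemma ccosB a b k : intq a -> intq b ->
  ccos (fun x => a x - b x) k = ccos a k - ccos b k.
Proof.
move=> ai bi; have mQ := @measurable_cube R d.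
rewrite -RintegralB//; do ?exact: integrable_mul_cos.
by apply: eq_Rintegral => x _; rewrite mulrBl.
Qed.

Lemma csinB a b k : intq a -> intq b ->
  csin (fun x => a x - b x) k = csin a k - csin b k.
Proof.
move=> ai bi; have mQ := @measurable_cube R d.
rewrite -RintegralB//; do ?exact: integrable_mul_sin.
by apply: eq_Rintegral => x _; rewrite mulrBl.
Qed.

Lemma ccos_opp a k : intq a -> ccos (fun x => - a x) k = - ccos a k.
Proof.
move=> ai; have mQ := @measurable_cube R d.
rewrite -mulN1r -RintegralZl//; last exact: integrable_mul_cos.
by apply: eq_Rintegral => x _; rewrite mulNr mulN1r.
Qed.

Lemma csin_opp a k : intq a -> csin (fun x => - a x) k = - csin a k.
Proof.
move=> ai; have mQ := @measurable_cube R d.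
rewrite -mulN1r -RintegralZl//; last exact: integrable_mul_sin.
by apply: eq_Rintegral => x _; rewrite mulNr mulN1r.
Qed.

Lemma ccos_tneg a k : intq a -> ccos (a \o @tneg R d) k = ccos a k.
Proof.
move=> ai; have mQ := @measurable_cube R d.
rewrite /ccos -(@Rintegral_tneg _ _ _ mu_leb (fun x => a x * cos (ip k x))).
  by apply: eq_Rintegral => x _; rewrite ip_tneg cosN.
exact: integrable_mul_cos.
Qed.

Lemma csin_tneg a k : intq a -> csin (a \o @tneg R d) k = - csin a k.
Proof.
move=> ai; have mQ := @measurable_cube R d.
rewrite -csinN// /csin.
rewrite -(@Rintegral_tneg _ _ _ mu_leb (fun x => a x * sin (ip (fun l => - k l) x))).
  by apply: eq_Rintegral => x _; rewrite ip_tneg ipN opprK.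
exact: integrable_mul_sin.
Qed.

Lemma fourier_unique_iff a : intq a ->
  (forall k, ccos a k = 0 /\ csin a k = 0) <->
  {ae mu, forall x, cube x -> a x = 0}.
Proof.
move=> ai; split=> [H|a0 k].
  by apply: fourier_unique => // k; have [] := H k.
have mQ := @measurable_cube R d.
have R0 g : mu.-integrable cube (EFin \o g) ->
    (forall x, a x = 0 -> g x = 0) -> \int[mu]_(x in cube) g x = 0.
  move=> gi ag; rewrite /Rintegral (@ae_eq_integral _ _ _ mu _ (cst 0%E))//.
  - by rewrite integral0.
  - exact: measurable_int gi.
  - by apply: filterS a0 => x ax Qx /=; rewrite ag// ax.
split; apply: R0.
- exact: integrable_mul_cos.
- by move=> x ->; rewrite mul0r.
- exact: integrable_mul_sin.
- by move=> x ->; rewrite mul0r.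
Qed.

(* The system at k and at -k decouples the two unknowns. *)
Lemma fourier_hermitian_iff a b a' b' : intq a -> intq b -> intq a' -> intq b' ->
  (forall k, fourier_re a b k = fourier_re a' b' (fun l => - k l) /\
             fourier_im a b k = - fourier_im a' b' (fun l => - k l)) <->
  {ae mu, forall x, cube x -> a x = a' x /\ b x = - b' x}.
Proof.
move=> ai bi ai' bi'; have mQ := @measurable_cube R d.
have abi : intq (fun x => a x - a' x) by have := integrableB mQ ai ai'.
have bbi : intq (fun x => b x + b' x) by have := integrableD mQ bi bi'.
have E : (forall k, fourier_re a b k = fourier_re a' b' (fun l => - k l) /\
             fourier_im a b k = - fourier_im a' b' (fun l => - k l)) <->
  (forall k, (ccos (fun x => a x - a' x) k = 0 /\
              csin (fun x => a x - a' x) k = 0)) /\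
  (forall k, (ccos (fun x => b x + b' x) k = 0 /\
              csin (fun x => b x + b' x) k = 0)).
  split=> [H|[H1 H2] k]; last first.
    rewrite !fourier_reE// !fourier_imE// !ccosN !csinN//.
    have := H1 k; have := H2 k; rewrite ccosB// ccosD// csinB// csinD//.
    by move=> [? ?] [? ?]; split; lra.
  suff S k : [/\ ccos (fun x => a x - a' x) k = 0,
              csin (fun x => a x - a' x) k = 0,
              ccos (fun x => b x + b' x) k = 0 &
              csin (fun x => b x + b' x) k = 0].
    by split=> k; have [] := S k.
  have := H k; have := H (fun l => - k l).
  rewrite !fourier_reE// !fourier_imE// !ccosN !csinN//.
  rewrite ccosB// ccosD// csinB// csinD//.
  by move=> [? ?] [? ?]; split; lra.
apply: (iff_trans E).
rewrite !fourier_unique_iff//; split.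
- move=> [H1 H2]; apply: filterS2 H1 H2 => x H1 H2 Qx.
  by split; apply/eqP; rewrite -subr_eq0 ?opprK; apply/eqP; [exact: H1|exact: H2].
- by move=> H; split; apply: filterS H => x H Qx; have [h1 h2] := H Qx;
    rewrite ?h1 ?h2 ?subrr ?addNr.
Qed.

(** Put f' = a' + i b'. The function -conj(f'(-x)) has as coefficients the negated conjugates of
    those of f', so [fourier_hermitian_iff] applies with it in place of f'. *)
Lemma fourier_antisym_iff a b a' b' : intq a -> intq b -> intq a' -> intq b' ->
  (forall k, fourier_re a b k = - fourier_re a' b' (fun l => - k l) /\
             fourier_im a b k = - fourier_im a' b' (fun l => - k l)) <->
  {ae mu, forall x, cube x -> a' (tneg x) = - a x /\ b' (tneg x) = - b x}.
Proof.
move=> ai bi ai' bi'; have mQ := @measurable_cube R d.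
have ati : intq (a' \o @tneg R d) by exact: (integrable_tneg mu_leb ai').
have bti : intq (b' \o @tneg R d) by exact: (integrable_tneg mu_leb bi').
have nai : intq (fun x => - a' (tneg x)) by have := integrableN ati.
have NA : forall k, ccos (fun x => - a' (tneg x)) k = - ccos a' k /\
   csin (fun x => - a' (tneg x)) k = csin a' k.
  move=> k; rewrite (@ccos_opp (a' \o @tneg R d))// ccos_tneg//.
  by rewrite (@csin_opp (a' \o @tneg R d))// csin_tneg// opprK.
have := @fourier_hermitian_iff a b (fun x => - a' (tneg x)) (b' \o @tneg R d) ai bi nai bti.
move=> H; apply: iff_trans (iff_trans _ H) _.
  split=> E k; have := E k; rewrite !fourier_reE// !fourier_imE// !ccosN !csinN//.
    rewrite ccos_tneg// csin_tneg// (NA k).1 (NA k).2.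
    by move=> [? ?]; split; lra.
  rewrite ccos_tneg// csin_tneg// (NA k).1 (NA k).2.
  by move=> [? ?]; split; lra.
by split; apply: filterS => x Hx Qx; have [h1 h2] := Hx Qx; split;
  move: h1 h2 => /=; lra.
Qed.
End fourier.

(** * From Toeplitz matrices to the symmetries of Z and W *)

Section toeplitz.
Variables (R : realType) (d s : nat) (mu : {measure set (d.-tuple R) -> \bar R}).
Local Notation pt := (d.-tuple R).
Local Notation cube := (@cube R d).
Local Notation torus := (@torus R d).
Implicit Types (k : 'I_d -> int) (Z W : pt -> 'M[R[i]]_s).

Lemma toeplitz_hermitianE (F : pt -> 'I_s -> 'I_s -> quat R)
  (SL SR : {set 'I_d}) :
  toeplitz_hermitian mu F SL SR <->
  forall k p q, sandwich_coef mu F SL SR k p q =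
    qconj (sandwich_coef mu F SL SR (fun l => - k l) q p).
Proof.
split=> [H k p q|H n a b _ _].
(* The positive and negative parts of k are two multi-indices with difference k; the size alpha +
   beta + 1 makes both admissible. *)
- pose alpha l := if 0 <= k l then `|k l|%N else 0%N.
  pose beta l := if 0 <= k l then 0%N else `|k l|%N.
  have kE : (fun l => (alpha l)%:Z - (beta l)%:Z) = k.
    apply/funext => l; rewrite /alpha /beta; case: ifPn => [k0|].
      by rewrite subr0 gez0_abs.
    by rewrite -ltNge => k0; rewrite sub0r ltz0_abs// opprK.
  have kN : (fun l => (beta l)%:Z - (alpha l)%:Z) = (fun l => - k l).
    by rewrite -kE; apply/funext => l; rewrite opprB.
  have := H (fun l => (alpha l + beta l).+1) (alpha, p) (beta, q).
  rewrite /sandwich_toeplitz [(_, p).1]/= [(_, q).1]/= kE kN; apply.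
  - by move=> l /=; rewrite ltnS leq_addr.
  - by move=> l /=; rewrite ltnS leq_addl.
- rewrite /sandwich_toeplitz H.
  suff -> : (fun l => - ((a.1 l)%:Z - (b.1 l)%:Z)) =
            (fun l => (b.1 l)%:Z - (a.1 l)%:Z) by [].
  by apply/funext => l; rewrite opprB.
Qed.

(** The frequency seen by the coefficient of j, whose right exponentials are conjugated. *)
Definition twist (SR : {set 'I_d}) k : 'I_d -> int :=
  fun l => if l \in SR then - k l else k l.

Lemma twistK SR : involutive (twist SR).
Proof.
by move=> k; apply/funext => l; rewrite /twist; case: (l \in SR); rewrite ?opprK.
Qed.

Lemma twistN SR k : twist SR (fun l => - k l) = fun l => - twist SR k l.
Proof. by apply/funext => l; rewrite /twist; case: ifP. Qed.

Section partition.
Variables SL SR : {set 'I_d}.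
Hypothesis part : ordered_partition SL SR.

Lemma mem_left l : (l \in SL) = (l \notin SR).
Proof.
case: part => disj cov.
have := finset.in_set0 l; rewrite -disj inE; have := finset.in_setT l; rewrite -cov inE.
by case: (l \in SL); case: (l \in SR).
Qed.

Lemma ipS_add k (x : pt) : ipS SL k x + ipS SR k x = ip k x.
Proof.
rewrite ipE (bigID (mem SR))/= addrC /ipS; congr (_ + _).
by apply: eq_bigl => l; rewrite mem_left.
Qed.

Lemma ipS_sub k (x : pt) : ipS SL k x - ipS SR k x = ip (twist SR k) x.
Proof.
rewrite ipE (bigID (mem SR))/= addrC /ipS; congr (_ + _);
  last by rewrite -sumrN; apply: eq_bigr => l lR; rewrite /twist lR mulrNz mulNr.
apply: eq_big => [l|l]; first by rewrite mem_left.
by rewrite mem_left /twist => /negbTE ->.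
Qed.

Hypothesis mu_leb : is_lebesgue_tuple mu.
Variables Z W : pt -> 'M[R[i]]_s.
Hypotheses (LZ : L1_cmat mu Z) (LW : L1_cmat mu W).

Local Notation re := (fun M p q => fun x => complex.Re ((M : pt -> 'M[R[i]]_s) x p q)).
Local Notation im := (fun M p q => fun x => complex.Im ((M : pt -> 'M[R[i]]_s) x p q)).

Lemma torus_to_cube (a : pt -> R) :
  mu.-integrable torus (fun x => (a x)%:E) -> mu.-integrable cube (EFin \o a).
Proof.
apply: integrableS; [exact: measurable_torus|exact: measurable_cube|].
exact: cube_torus.
Qed.

Lemma sandwich_coefE k p q :
  sandwich_coef mu (qmatfun Z W) SL SR k p q =
  qscale ((2 * pi) ^- d)
   (Quat (fourier_re mu (re Z p q) (im Z p q) k +i*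
          fourier_im mu (re Z p q) (im Z p q) k)
         (fourier_re mu (re W p q) (im W p q) (twist SR k) +i*
          fourier_im mu (re W p q) (im W p q) (twist SR k))).
Proof.
have [zr zi] := LZ p q; have [wr wi] := LW p q.
have mT := @measurable_torus R d.
have intD a b j : mu.-integrable torus (fun x => (a x)%:E) ->
    mu.-integrable torus (fun x => (b x)%:E) -> mu.-integrable torus
      (EFin \o (fun x => a x * cos (ip j x) + b x * sin (ip j x))).
  move=> ai bi.
  by have := integrableD mT (integrable_mul_cos j mT ai) (integrable_mul_sin j mT bi).
have intB a b j : mu.-integrable torus (fun x => (a x)%:E) ->
    mu.-integrable torus (fun x => (b x)%:E) -> mu.-integrable torus
      (EFin \o (fun x => a x * cos (ip j x) - b x * sin (ip j x))).
  move=> ai bi.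
  by have := integrableB mT (integrable_mul_cos j mT ai) (integrable_mul_sin j mT bi).
rewrite /sandwich_coef.
under eq_fun do rewrite qmul_sandwich ipS_add ipS_sub.
congr (qscale _ (Quat (_ +i* _) (_ +i* _))) => /=.
- exact: (Rintegral_torus mu_leb (intD _ _ k zr zi)).
- exact: (Rintegral_torus mu_leb (intB _ _ k zi zr)).
- exact: (Rintegral_torus mu_leb (intD _ _ (twist SR k) wr wi)).
- exact: (Rintegral_torus mu_leb (intB _ _ (twist SR k) wi wr)).
Qed.

Lemma toeplitz_hermitian_iff :
  toeplitz_hermitian mu (qmatfun Z W) SL SR <->
  ({ae mu, forall x, torus x -> Z x = map_mx (fun z => z^*) (Z x)^T} /\
   {ae mu, forall x, torus x -> W (tneg x) = - (W x)^T}).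
Proof.
have c0 : (2 * pi : R) ^- d != 0.
  by rewrite invr_neq0// expf_neq0// mulf_neq0// lt0r_neq0// pi_gt0.
(* Quaternion conjugation conjugates the Z-coefficient but only negates the W-coefficient; the
   nonzero factor (2 pi)^-d cancels. *)
have E k p q : sandwich_coef mu (qmatfun Z W) SL SR k p q =
    qconj (sandwich_coef mu (qmatfun Z W) SL SR (fun l => - k l) q p) <->
  (fourier_re mu (re Z p q) (im Z p q) k =
   fourier_re mu (re Z q p) (im Z q p) (fun l => - k l) /\
   fourier_im mu (re Z p q) (im Z p q) k =
   - fourier_im mu (re Z q p) (im Z q p) (fun l => - k l)) /\
  (fourier_re mu (re W p q) (im W p q) (twist SR k) =
   - fourier_re mu (re W q p) (im W q p) (fun l => - twist SR k l) /\
   fourier_im mu (re W p q) (im W p q) (twist SR k) =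
   - fourier_im mu (re W q p) (im W q p) (fun l => - twist SR k l)).
  rewrite !sandwich_coefE twistN /qscale /qconj /=.
  split=> [[]|[[-> ->] [-> ->]]].
    rewrite !mul0r !subr0 !addr0.
    move=> /(mulfI c0) -> /eqP; rewrite -mulrN => /eqP/(mulfI c0) ->.
    rewrite -mulrN => /(mulfI c0) -> /eqP; rewrite -mulrN => /eqP/(mulfI c0) ->.
    by [].
  by congr Quat; congr Complex; ring.
rewrite toeplitz_hermitianE.
have -> : (forall k p q, sandwich_coef mu (qmatfun Z W) SL SR k p q =
    qconj (sandwich_coef mu (qmatfun Z W) SL SR (fun l => - k l) q p)) <->
  (forall p q, {ae mu, forall x, cube x ->
     re Z p q x = re Z q p x /\ im Z p q x = - im Z q p x}) /\
  (forall p q, {ae mu, forall x, cube x ->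
     re W q p (tneg x) = - re W p q x /\ im W q p (tneg x) = - im W p q x}).
  split.
  - move=> H; split=> p q; have [zr zi] := LZ p q; have [zr' zi'] := LZ q p;
    have [wr wi] := LW p q; have [wr' wi'] := LW q p.
    + apply/(fourier_hermitian_iff (torus_to_cube zr) (torus_to_cube zi)
       (torus_to_cube zr') (torus_to_cube zi')) => k.
      by have /E[] := H k p q.
    + apply/(fourier_antisym_iff mu_leb (torus_to_cube wr) (torus_to_cube wi)
       (torus_to_cube wr') (torus_to_cube wi')) => k.
      (* Since [twist] is an involution, evaluating at the twisted frequency gives the condition on
         W at k itself. *)
      by have /E[_] := H (twist SR k) p q; rewrite twistK.
  - move=> [HZ HW] k p q; have [zr zi] := LZ p q; have [zr' zi'] := LZ q p;
    have [wr wi] := LW p q; have [wr' wi'] := LW q p; apply/E; split.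
    + have /(fourier_hermitian_iff (torus_to_cube zr) (torus_to_cube zi)
       (torus_to_cube zr') (torus_to_cube zi')) := HZ p q.
      exact.
    + have /(fourier_antisym_iff mu_leb (torus_to_cube wr) (torus_to_cube wi)
       (torus_to_cube wr') (torus_to_cube wi')) := HW p q.
      exact.
have TQ := ae_torus_cube mu_leb.
split=> [[HZ HW]|[HZ HW]]; split.
(* There are finitely many entries, so a single null set serves for all of them. *)
- have {}HZ : {ae mu, forall x, forall p q, cube x ->
     re Z p q x = re Z q p x /\ im Z p q x = - im Z q p x}.
    by do 2! apply: filter_forall => ?.
  apply: filterS2 HZ TQ => x HZ TQ Tx; apply/matrixP => p q; rewrite !mxE.
  have [] := HZ p q (TQ Tx).
  by case: (Z x p q) (Z x q p) => [a b] [a' b'] /= -> ->.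
- have {}HW : {ae mu, forall x, forall p q, cube x ->
     re W q p (tneg x) = - re W p q x /\ im W q p (tneg x) = - im W p q x}.
    by do 2! apply: filter_forall => ?.
  apply: filterS2 HW TQ => x HW TQ Tx; apply/matrixP => q p; rewrite !mxE.
  have [] := HW p q (TQ Tx).
  by case: (W x p q) (W (tneg x) q p) => [a b] [a' b'] /= -> ->.
- move=> p q; apply: filterS HZ => x HZ Qx.
  have /matrixP/(_ p q) := HZ (cube_torus Qx); rewrite !mxE => ->.
  by case: (Z x q p).
- move=> p q; apply: filterS HW => x HW Qx.
  have /matrixP/(_ q p) := HW (cube_torus Qx); rewrite !mxE => ->.
  by case: (W x p q).
Qed.

End partition.
End toeplitz.
Unset Implicit Arguments.

Theorem mainTheorem8 (R : realType) (d s : nat)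
  (mu : {measure set (d.-tuple R) -> \bar R})
  (Z W : d.-tuple R -> 'M[R[i]]_s) :
  is_lebesgue_tuple mu ->
  L1_cmat mu Z -> L1_cmat mu W ->
  (forall SL SR : {set 'I_d}, ordered_partition SL SR ->
     (toeplitz_hermitian mu (qmatfun Z W) SL SR <->
      ({ae mu, forall x, torus x -> Z x = map_mx (fun z => z^*) (Z x)^T} /\
       {ae mu, forall x, torus x -> W (tneg x) = - (W x)^T})))
  /\
  (forall SL SR SL' SR' : {set 'I_d},
     ordered_partition SL SR -> ordered_partition SL' SR' ->
     (toeplitz_hermitian mu (qmatfun Z W) SL SR <->
      toeplitz_hermitian mu (qmatfun Z W) SL' SR')).
Proof.
move=> mu_leb LZ LW; split=> [SL SR|SL SR SL' SR'] part => [|part'].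
  exact: toeplitz_hermitian_iff.
exact: iff_trans (toeplitz_hermitian_iff part mu_leb LZ LW)
  (iff_sym (toeplitz_hermitian_iff part' mu_leb LZ LW)).
Qed.
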